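(* Let $G\subset S_N^+$ be a closed quantum subgroup with magic unitary $u=(u_{ij})$. If $C(G)$ has a doubly flat matrix model $\pi:C(G)\to M_K(C(X))$, then $G$ must be doubly transitive. The same happens for triple flatness and triple transitivity: if $C(G)$ has a triple flat matrix model $\pi:C(G)\to M_K(C(X))$, then $G$ must be $3$-transitive.
   Context: A magic unitary is a square matrix $u\in M_N(A)$ over a unital $C^*$-algebra $A$ whose entries are projections summing up to $1$ on each row and each column. The quantum permutation group $S_N^+$ is the compact quantum group (in the sense of Woronowicz) whose algebra $C(S_N^+)$ is the universal $C^*$-algebra generated by the entries of an $N\times N$ magic unitary $u=(u_{ij})$, with comultiplication $\Delta(u_{ij})=\sum_k u_{ik}\otimes u_{kj}$, counit $\varepsilon(u_{ij})=\delta_{ij}$ and antipode $S(u_{ij})=u_{ji}$. A closed subgroup $G\subset S_N^+$ is a compact quantum group given by a quotient $C(S_N^+)\to C(G)$ compatible with these structural maps; its magic unitary, still denoted $u$, is the image of the universal one. $G$ is doubly transitive when $u_{ij}u_{kl}\neq0$ for any $i\neq k$, $j\neq l$. $G$ is $3$-transitive when $\dim(\mathrm{Fix}(u^{\otimes 3}))=5$, where $\mathrm{Fix}(u^{\otimes 3})\subset(\mathbb C^N)^{\otimes 3}$ is the space of fixed vectors of the corepresentation $u^{\otimes 3}=(u_{i_1j_1}u_{i_2j_2}u_{i_3j_3})$. A matrix model for $C(G)$ is a unital $*$-homomorphism $\pi:C(G)\to M_K(C(X))$, with $K\in\mathbb N$ and $X$ a compact space; we write $P_{ij}=\pi(u_{ij})$,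 and $tr$ is the normalized trace of $K\times K$ matrices, applied at each point of $X$ (so that the equalities below are equalities of functions on $X$). The model is doubly flat when, for all $i,j,k,l$, $$tr(P_{ij}P_{kl})=\begin{cases}\frac1N&\text{if } i=k,\ j=l\\ 0&\text{if } i=k,\ j\neq l\ \text{ or }\ i\neq k,\ j=l\\ \frac{1}{N(N-1)}&\text{if } i\neq k,\ j\neq l.\end{cases}$$ The model is triple flat when $tr(P_{ij}P_{kl}P_{pq})=\frac{1}{N(N-1)(N-2)}$ for any $i,k,p$ distinct and any $j,l,q$ distinct.
   Formalization: The claim on 3-transitivity is stated for N ≥ 3, since for N = 1, 2 triple flatness is vacuous while dim Fix(u^{⊗3}) is never 5; the models are taken with K ≥ 1 and X nonempty, since otherwise flatness is vacuous or the normalized trace is undefined. *)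

(* Defs.v *)
From HB Require Import structures.
From mathcomp Require Import all_boot all_order all_algebra.
From mathcomp Require Import all_classical all_reals all_analysis.
From mathcomp Require Import complex.

Set Implicit Arguments.
Unset Strict Implicit.
Unset Printing Implicit Defensive.

Import Order.TTheory GRing.Theory Num.Theory.
Import numFieldNormedType.Exports.

Local Open Scope classical_set_scope.
Local Open Scope ring_scope.

(* Throughout, C is the field of complex numbers; it is kept abstract as a
   numClosedFieldType, to be instantiated by R[i] with R : realType, because the
   topology of a numClosedFieldType is found by its structure projection.  Norms
   take their values in C, as everywhere for normed modules over C. *)

(* The ring laws are fields of the mixin, rather than inherited from algType,
   because Hierarchy-Builder has no join of the normed and ring hierarchies below
   numDomainType.  The ring structure is declared right after. *)
HB.mixin Record isCStarAlgebra (C : numClosedFieldType) A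
    of CompleteNormedModule C A := {
  cstar_one : A ;
  cstar_mul : A -> A -> A ;
  star : A -> A ;
  cstar_mulA : associative cstar_mul ;
  cstar_mul1r : left_id cstar_one cstar_mul ;
  cstar_mulr1 : right_id cstar_one cstar_mul ;
  cstar_mulDl : left_distributive cstar_mul +%R ;
  cstar_mulDr : right_distributive cstar_mul +%R ;
  cstar_scalerAl : forall (c : C) (a b : A),
    c *: cstar_mul a b = cstar_mul (c *: a) b ;
  cstar_scalerAr : forall (c : C) (a b : A),
    c *: cstar_mul a b = cstar_mul a (c *: b) ;
  starD : {morph star : a b / a + b} ;
  starZ : forall (c : C) (a : A), star (c *: a) = c^* *: star a ;
  starM : forall a b : A, star (cstar_mul a b) = cstar_mul (star b) (star a) ;
  starK : involutive star ;
  cstar_normM : forall a b : A, `|cstar_mul a b| <= `|a| * `|b| ;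
  cstar_norm_star : forall a : A, `|cstar_mul (star a) a| = `|a| ^+ 2
}.

#[short(type = "cstarType")]
HB.structure Definition CStarAlgebra (C : numClosedFieldType) :=
  {A of CompleteNormedModule C A & isCStarAlgebra C A}.

HB.instance Definition _ (C : numClosedFieldType) (A : cstarType C) :=
  GRing.Zmodule_isPzRing.Build (CStarAlgebra.sort A)
    (@cstar_mulA C A) (@cstar_mul1r C A) (@cstar_mulr1 C A)
    (@cstar_mulDl C A) (@cstar_mulDr C A).

Section CStarTheory.
Variable C : numClosedFieldType.
Implicit Types A B T : cstarType C.

Definition star_hom A B (f : A -> B) :=
  [/\ linear f, GRing.monoid_morphism f & forall a, f (star a) = star (f a)].

Definition star_antihom A B (f : A -> B) :=
  [/\ linear f, f 1 = 1, forall a b, f (a * b) = f b * f a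
    & forall a, f (star a) = star (f a)].

Definition star_character A (f : A -> C) :=
  [/\ scalar f, GRing.monoid_morphism f & forall a, f (star a) = (f a)^*].

Definition cstar_subalgebra A (S : set A) :=
  [/\ closed S, S 1,
      forall (c : C) a b, S a -> S b -> S (c *: a + b),
      forall a b, S a -> S b -> S (a * b)
    & forall a, S a -> S (star a)].

Definition cstar_generated A (G : set A) :=
  forall S : set A, cstar_subalgebra S -> G `<=` S -> S = [set: A].

Definition lin_indep A n (a : 'I_n -> A) :=
  forall c : 'I_n -> C, \sum_k c k *: a k = 0 -> forall k, c k = 0.

(* T, with i1 a = a (x) 1 and i2 b = 1 (x) b, is the completion of the algebraic
   tensor product of A and B for some C*-norm.  The third clause says that the
   algebraic tensor product embeds into T. *)
Definition cstar_tensor A B T (i1 : A -> T) (i2 : B -> T) :=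
  [/\ star_hom i1 /\ star_hom i2,
      forall a b, i1 a * i2 b = i2 b * i1 a,
      forall n (a : 'I_n -> A) (b : 'I_n -> B), lin_indep a ->
        \sum_k i1 (a k) * i2 (b k) = 0 -> forall k, b k = 0
    & cstar_generated (range i1 `|` range i2)].

(* The minimal (spatial) tensor product: the completion for the least C*-norm. *)
Definition min_tensor A B T (i1 : A -> T) (i2 : B -> T) :=
  cstar_tensor i1 i2 /\
  forall T' (j1 : A -> T') (j2 : B -> T'), cstar_tensor j1 j2 ->
  forall n (a : 'I_n -> A) (b : 'I_n -> B),
    `|\sum_k i1 (a k) * i2 (b k)| <= `|\sum_k j1 (a k) * j2 (b k)|.

Definition projection A (p : A) := star p = p /\ p * p = p.

Definition magic_unitary A N (u : 'M[A]_N) :=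
  [/\ forall i j, projection (u i j),
      forall i, \sum_j u i j = 1
    & forall j, \sum_i u i j = 1].

Definition mx_entries A N (u : 'M[A]_N) : set A :=
  [set a | exists i j, a = u i j].

End CStarTheory.

(* A compact quantum group whose fundamental corepresentation is an N x N magic
   unitary u with entries generating the algebra.  Coassociativity of the
   comultiplication, and density of Delta(A)(1 (x) A) and Delta(A)(A (x) 1), are
   consequences of these fields. *)
Record magic_cqg (C : numClosedFieldType) (N : nat) := MagicCQG {
  cqg_alg :> cstarType C ;
  cqg_u : 'M[cqg_alg]_N ;
  cqg_tensor : cstarType C ;
  cqg_inl : cqg_alg -> cqg_tensor ;
  cqg_inr : cqg_alg -> cqg_tensor ;
  cqg_comul : cqg_alg -> cqg_tensor ;
  cqg_counit : cqg_alg -> C ;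
  cqg_antipode : cqg_alg -> cqg_alg ;
  cqg_magic : magic_unitary cqg_u ;
  cqg_generated : cstar_generated (mx_entries cqg_u) ;
  cqg_tensorP : min_tensor cqg_inl cqg_inr ;
  cqg_comul_hom : star_hom cqg_comul ;
  cqg_comul_u : forall i j, cqg_comul (cqg_u i j) =
    \sum_k cqg_inl (cqg_u i k) * cqg_inr (cqg_u k j) ;
  cqg_counit_hom : star_character cqg_counit ;
  cqg_counit_u : forall i j, cqg_counit (cqg_u i j) = (i == j)%:R ;
  cqg_antipode_hom : star_antihom cqg_antipode ;
  cqg_antipode_u : forall i j, cqg_antipode (cqg_u i j) = cqg_u j i
}.

Section QuantumPermutationGroups.
Variables (C : numClosedFieldType) (N : nat).
Implicit Types S G : magic_cqg C N.

(* C(S_N^+), up to isomorphism.  The map f is unique, since the entries of the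
   fundamental magic unitary of S generate S. *)
Definition quantum_permutation_group S :=
  forall (B : cstarType C) (v : 'M[B]_N), magic_unitary v ->
  exists2 f : S -> B, star_hom f & forall i j, f (cqg_u S i j) = v i j.

Definition closed_subgroup S G (q : S -> G) :=
  [/\ star_hom q /\ set_surj [set: S] [set: G] q,
      forall i j, q (cqg_u S i j) = cqg_u G i j,
      exists qq : cqg_tensor S -> cqg_tensor G,
        [/\ star_hom qq,
            forall a : S, qq (cqg_inl a) = cqg_inl (q a),
            forall a : S, qq (cqg_inr a) = cqg_inr (q a)
          & forall a : S, cqg_comul (q a) = qq (cqg_comul a)],
      forall a : S, cqg_counit (q a) = cqg_counit a
    & forall a : S, cqg_antipode (q a) = q (cqg_antipode a)].

Definition doubly_transitive G :=
  forall i j k l : 'I_N, i != k -> j != l -> cqg_u G i j * cqg_u G k l <> 0.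

Local Notation idx3 := ('I_N * 'I_N * 'I_N)%type.

Definition tensor_cube (A : cstarType C) (u : 'M[A]_N) (i j : idx3) : A :=
  u i.1.1 j.1.1 * u i.1.2 j.1.2 * u i.2 j.2.

(* (C^N)^{(x) 3} is identified with the functions on triples of indices. *)
Definition fixed3 G (xi : {ffun idx3 -> C^o}) :=
  forall i : idx3,
    \sum_(j : idx3) (xi j : C) *: tensor_cube (cqg_u G) i j
    = (xi i : C) *: (1 : G).

Definition three_transitive G :=
  exists2 V : {vspace {ffun idx3 -> C^o}},
    forall xi, xi \in V <-> fixed3 G xi & \dim V = 5%N.

End QuantumPermutationGroups.

Section ContinuousFunctions.
Variables (C : numClosedFieldType) (X : topologicalType).
Implicit Types f g h : continuousType X C.

Let cts_zero : continuous (fun _ : X => 0 : C).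
Proof. by move=> x; exact: cvg_cst. Qed.

Let cts_one : continuous (fun _ : X => 1 : C).
Proof. by move=> x; exact: cvg_cst. Qed.

Let cts_opp f : continuous (fun x => - f x : C).
Proof. by move=> x; apply: continuousN; exact: cts_fun. Qed.

Let cts_add f g : continuous (fun x => f x + g x : C).
Proof. by move=> x; apply: continuousD; exact: cts_fun. Qed.

Let cts_mul f g : continuous (fun x => f x * g x : C).
Proof. by move=> x; apply: continuousM; exact: cts_fun. Qed.

Let cts_conj f : continuous (fun x => (f x)^* : C).
Proof.
move=> x; apply/cvgrPdist_lt => e e0.
have /cvgrPdist_lt/(_ e e0) := cts_fun (s := f) x.
by apply: filterS => y; rewrite -rmorphB norm_conjC.
Qed.

Definition cfun0 : continuousType X C := mkcts cts_zero.
Definition cfun1 : continuousType X C := mkcts cts_one.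
Definition cfun_opp f : continuousType X C := mkcts (cts_opp (f := f)).
Definition cfun_add f g : continuousType X C := mkcts (cts_add (f := f) (g := g)).
Definition cfun_mul f g : continuousType X C := mkcts (cts_mul (f := f) (g := g)).
Definition cfun_conj f : continuousType X C := mkcts (cts_conj (f := f)).

Let addA : associative cfun_add.
Proof. by move=> f g h; apply/continuousEP => x; exact: addrA. Qed.
Let addC : commutative cfun_add.
Proof. by move=> f g; apply/continuousEP => x; exact: addrC. Qed.
Let add0 : left_id cfun0 cfun_add.
Proof. by move=> f; apply/continuousEP => x; exact: add0r. Qed.
Let addN : left_inverse cfun0 cfun_opp cfun_add.
Proof. by move=> f; apply/continuousEP => x; exact: addNr. Qed.

HB.instance Definition _ :=
  GRing.isZmodule.Build (continuousType X C) addA addC add0 addN.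

Let mulA : associative cfun_mul.
Proof. by move=> f g h; apply/continuousEP => x; exact: mulrA. Qed.
Let mulC : commutative cfun_mul.
Proof. by move=> f g; apply/continuousEP => x; exact: mulrC. Qed.
Let mul1 : left_id cfun1 cfun_mul.
Proof. by move=> f; apply/continuousEP => x; exact: mul1r. Qed.
Let mulD : left_distributive cfun_mul cfun_add.
Proof. by move=> f g h; apply/continuousEP => x; exact: mulrDl. Qed.

HB.instance Definition _ :=
  GRing.Zmodule_isComPzRing.Build (continuousType X C) mulA mulC mul1 mulD.

(* The ring C(X). *)
Definition cfun : comPzRingType := continuousType X C.

End ContinuousFunctions.

Section MatrixModels.
Variables (C : numClosedFieldType) (N : nat) (G : magic_cqg C N).
Variables (K : nat) (X : topologicalType).

Definition matrix_model (pi : G -> 'M[cfun C X]_K) :=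
  [/\ linear_for (fun c M => (cst c : cfun C X) *: M) pi,
      GRing.monoid_morphism pi
    & forall a, pi (star a) = (map_mx (@cfun_conj C X : cfun C X -> cfun C X) (pi a))^T].

(* Degenerate cases to be excluded by the user: for K = 0 or X empty the target
   is the zero ring, and triple_flat is vacuous for N < 3. *)
Definition ntr (M : 'M[cfun C X]_K) (x : X) : C :=
  (\tr M : continuousType X C) x / K%:R.

Definition doubly_flat (pi : G -> 'M[cfun C X]_K) :=
  let P i j := pi (cqg_u G i j) in
  forall (i j k l : 'I_N) (x : X),
    ntr (P i j *m P k l) x =
      if (i == k) && (j == l) then N%:R^-1
      else if (i == k) || (j == l) then 0
      else (N%:R * (N%:R - 1))^-1.

Definition triple_flat (pi : G -> 'M[cfun C X]_K) :=
  let P i j := pi (cqg_u G i j) in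
  forall (i j k l p q : 'I_N) (x : X), uniq [:: i; k; p] -> uniq [:: j; l; q] ->
    ntr (P i j *m P k l *m P p q) x =
      (N%:R * (N%:R - 1) * (N%:R - 2))^-1.

End MatrixModels.

(* Main.v *)
(* Double flatness makes a nonzero trace out of each product u_ij u_kl.  For the
   triple case, composing the model with the normalized trace at a point of X
   gives a tracial functional tau on C(G), and tau applied to the equations of a
   fixed vector xi reads xi_i = sum_j tau(u_{i1j1} u_{i2j2} u_{i3j3}) xi_j.  By
   triple flatness and the orthogonality of the entries in each row and column,
   these coefficients vanish unless i and j have the same kernel (the same
   coincidences among the three indices), and otherwise depend on that kernel
   only.  So xi is constant on each of the five kernel classes, and the converse
   holds because the indicators i |-> [pi <= ker i] of the five partitions pi of
   {1,2,3} are fixed.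

   The orthogonality of projections summing to 1 is proved from the norm axioms
   alone, without positivity: in the corner with unit e = p_i, the elements
   b_k = p_i p_k p_i (k <> i) sum to 0 and satisfy |e - b_k| <= 1, so a small
   multiple h of b_k has both e + h and e - h in the unit ball, which forces
   h = 0 as e is an extreme point. *)

Require Import Defs.
From HB Require Import structures.
From mathcomp Require Import all_boot all_order all_algebra.
From mathcomp Require Import all_classical all_reals all_analysis.
From mathcomp Require Import complex ring.

Set Implicit Arguments.
Unset Strict Implicit.
Unset Printing Implicit Defensive.

Import Order.TTheory GRing.Theory Num.Theory.
Import numFieldNormedType.Exports.

Local Open Scope classical_set_scope.
Local Open Scope ring_scope.

(** * Archimedean and arithmetic preliminaries *)

Lemma mulrn_bounded_eq0 (R : realType) (x y : R[i]) :
  0 <= x -> 0 <= y -> (forall n, x *+ n <= y) -> x = 0.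
Proof.
(* The order on [R[i]] makes [x] real and compares real parts, so the Archimedean property of [R]
   applies. *)
case: x y => a b [c d]; rewrite !lecE /= => /andP[/eqP -> a0] _ le_xy.
suff -> : a = 0 by [].
apply/eqP; rewrite eq_le a0 andbT leNgt; apply/negP => {}a0.
have [n] : exists n, c < a *+ n.
  exists (Num.truncn (c / a)).+1.
  by rewrite -mulr_natr mulrC -ltr_pdivrMr// truncnS_gt.
have := le_xy n.
rewrite -mulr_natr -(rmorph_nat (real_complex R)) lecE => /andP[_ /=].
by rewrite mulr0 subr0 mulr_natr leNgt => /negbTE ->.
Qed.

Lemma mulr_polarization (T : pzRingType) (a b c d : T) :
  (a + b) * (c + d) + (a - b) * (c - d) = (a * c + b * d) *+ 2.
Proof.
rewrite !mulrDl !mulrDr !mulNr !mulrN opprK mulr2n addrACA.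
rewrite [X in X + _]addrACA subrr addr0 [X in _ + X]addrACA subrr add0r.
by rewrite addrACA.
Qed.

(** With [k] in the role of h^2 and [g] of (3/2)h, this is the convex combination 3/4 (e + h)^2 +
    1/4 (e - 3h^2), cleared of denominators. *)
Lemma mulrn_comb4 (V : zmodType) (e g h k : V) : g *+ 2 = h *+ 3 ->
  (e + g) *+ 4 = (e + k + h *+ 2) *+ 3 + (e - k *+ 3).
Proof.
move=> gh; rewrite (mulrnDl 4).
have -> : g *+ 4 = h *+ 6 by rewrite (mulrnA g 2 2) gh -mulrnA.
rewrite [in RHS](mulrnDl 3) [in RHS](mulrnDl 3) -mulrnA [RHS]addrACA mulrSr.
move: (e *+ 3) (h *+ 6) (k *+ 3) => x y z.
by rewrite [x + z]addrC -[z + x + e]addrA [y - z]addrC addrACA subrr add0r.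
Qed.

Lemma mulrn_scale_3half (F : numFieldType) (V : lmodType F) (v : V) :
  (3 / 2 : F) *: v *+ 2 = v *+ 3.
Proof.
by rewrite -[LHS]scaler_nat -[RHS]scaler_nat scalerA mulrC divfK.
Qed.

(** Thanks to the doubling, each step of the induction gains (3/2)^n, which is at least 1. *)
Lemma ler_nat_expr_3half (F : numFieldType) n : n%:R <= (3 / 2 : F) ^+ n *+ 2.
Proof.
elim: n => [|n IHn]; first by rewrite expr0 ler0n.
have x1 : (1 : F) <= (3 / 2) ^+ n.
  by rewrite exprn_ege1// ler_pdivlMr// mul1r ler_nat.
rewrite exprS -[leRHS]mulrnAl -[_ / _ *+ _]mulr_natr divfK//.
rewrite [leRHS]mulr_natl [leRHS]mulrSr [leLHS]mulrSr.
exact: lerD.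
Qed.

(** * Unit ball of a corner, and orthogonality of projections summing to 1 *)

Section CStarNorm.
Variables (R : realType) (A : cstarType R[i]).
Implicit Types (a b e h p : A) (c : R[i]).

Lemma cstar_scaleMl c a b : (c *: a) * b = c *: (a * b).
Proof. by rewrite [RHS]cstar_scalerAl. Qed.

Lemma cstar_scaleMr c a b : a * (c *: b) = c *: (a * b).
Proof. by rewrite [RHS]cstar_scalerAr. Qed.

Lemma cstar_ball1M a b : `|a| <= 1 -> `|b| <= 1 -> `|a * b| <= 1.
Proof.
move=> a1 b1; apply: le_trans (cstar_normM a b) _.
by rewrite mulr_ile1.
Qed.

Lemma normr_mulrn_le n a (B : R[i]) :
  (0 < n)%N -> `|a *+ n| <= B *+ n -> `|a| <= B.
Proof.
move=> n0; rewrite -scaler_nat normrZ normr_nat -[leRHS]mulr_natl.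
by rewrite ler_pM2l ?ltr0n.
Qed.

Lemma starN a : star (- a) = - star a.
Proof. by rewrite -scaleN1r starZ rmorphN rmorph1 scaleN1r. Qed.

Lemma star_mulr a b : star (a * b) = star b * star a.
Proof. exact: starM. Qed.

Lemma star0 : star (0 : A) = 0.
Proof. by rewrite -(scale0r (0 : A)) starZ rmorph0 !scale0r. Qed.

Lemma projection_norm_le1 p : projection p -> `|p| <= 1.
Proof.
move=> [sp pp].
have := cstar_norm_star p; rewrite sp -[cstar_mul _ _]/(p * p) pp expr2.
have [->|p0] := eqVneq `|p| 0; first by rewrite ler01.
by rewrite -{1}[`|p|]mulr1 => /(mulfI p0) <-.
Qed.

Lemma cstar_eq0 a : star a * a = 0 -> a = 0.
Proof.
move=> a0; apply/normr0_eq0/eqP; rewrite -sqrf_eq0 -cstar_norm_star.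
by rewrite -[cstar_mul _ _]/(star a * a) a0 normr0.
Qed.

(** By the C*-identity, the square of the norm of e + ih is the norm of (e - ih)(e + ih) = e + h^2,
    the mean of (e + h)^2 and (e - h)^2. *)
Lemma corner_unit_ball_i e h : projection e -> star h = h ->
  e * h = h -> h * e = h -> `|e + h| <= 1 -> `|e - h| <= 1 ->
  `|e + 'i%R *: h| <= 1.
Proof.
move=> [e_sa ee] h_sa eh he hp hm.
have e_hh : `|e + h * h| <= 1.
  apply: (@normr_mulrn_le 2) => //.
  rewrite -{1}ee -mulr_polarization mulr2n.
  by apply: le_trans (ler_normD _ _) _; rewrite lerD// cstar_ball1M.
rewrite -(@expr_le1 _ 2)// -cstar_norm_star -[cstar_mul _ _]/(star _ * _).
rewrite starD starZ conjCi e_sa h_sa scaleNr mulrDl !mulrDr mulNr.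
rewrite cstar_scaleMr !cstar_scaleMl cstar_scaleMr ee eh he.
rewrite addrA addrK mulNr cstar_scaleMl scalerN scalerA -expr2 sqrCi.
by rewrite scaleN1r opprK.
Qed.

(* e - 3h^2 is the mean of (e + ih)^3 and (e - ih)^3, and e + (3/2)h is the
   combination of (e + h)^2 and e - 3h^2 with weights 3/4 and 1/4.  Iterating,
   the powers of 3/2 times h stay bounded. *)
Lemma corner_unit_ball_expand e h : projection e -> star h = h ->
  e * h = h -> h * e = h -> `|e + h| <= 1 -> `|e - h| <= 1 ->
  `|e + (3 / 2) *: h| <= 1.
Proof.
move=> e_proj h_sa eh he hp hm; have [e_sa ee] := e_proj.
pose k := 'i%R *: h.
have kp : `|e + k| <= 1 by apply: corner_unit_ball_i.
have km : `|e - k| <= 1.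
  rewrite /k -scalerN; apply: corner_unit_ball_i => //.
  - by rewrite starN h_sa.
  - by rewrite mulrN eh.
  - by rewrite mulNr he.
  - by rewrite opprK.
have ek : e * k = k by rewrite cstar_scaleMr eh.
have ke : k * e = k by rewrite cstar_scaleMl he.
have kk : k * k = - (h * h).
  by rewrite cstar_scaleMr cstar_scaleMl scalerA -expr2 sqrCi scaleN1r.
have sqr_corner x : e * x = x -> x * e = x ->
    (e + x) * (e + x) = (e + x * x) + x *+ 2.
  move=> ex xe; rewrite mulrDl !mulrDr ee ex xe mulr2n.
  by rewrite -!addrA; congr (_ + _); rewrite addrA addrC.
have hh3 : `|e - (h * h) *+ 3| <= 1.
  apply: (@normr_mulrn_le 2) => //.
  have -> : (e - (h * h) *+ 3) *+ 2 =
      (e + k) * (e + k) * (e + k) + (e - k) * (e - k) * (e - k).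
    (* Each cube is ((e + k^2) ± 2k)(e ± k); polarization keeps the even part e + 3k^2, twice. *)
    rewrite [X in _ = X * _ + _]sqr_corner//.
    rewrite [X in _ = _ + X * _]sqr_corner ?mulrN ?mulNr ?ek ?ke// opprK.
    rewrite mulNrn mulr_polarization mulrDl ee -mulrA ke kk mulrnAl kk.
    by rewrite -addrA -mulrS mulNrn.
  rewrite mulr2n; apply: le_trans (ler_normD _ _) _.
  by rewrite lerD// !cstar_ball1M.
apply: (@normr_mulrn_le 4) => //.
have -> : (e + (3 / 2) *: h) *+ 4 =
    ((e + h) * (e + h)) *+ 3 + (e - (h * h) *+ 3).
  by rewrite sqr_corner//; apply: mulrn_comb4; exact: mulrn_scale_3half.
apply: le_trans (ler_normD _ _) _.
rewrite [leRHS]mulrSr normrMn.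
by rewrite lerD ?lerMn2r// cstar_ball1M.
Qed.

Lemma projection_compl p : projection p -> projection (1 - p).
Proof.
move=> [sp pp]; split; last first.
  by rewrite mulrBl mul1r mulrBr mulr1 pp subrr subr0.
have star1 : star (1 : A) = 1.
  rewrite -[LHS]mulr1 -[X in _ * X](starK 1) -[LHS]star_mulr.
  by rewrite -[X in star X]/(star 1 * 1) mulr1 starK.
by rewrite starD starN star1 sp.
Qed.

(** The expansion by 3/2 applies to both [h] and [- h], hence iterates: every (3/2)^n h has norm at
    most 1, so n|h| <= 2 for all n. *)
Lemma corner_unit_ball_eq0 e h : projection e -> star h = h ->
  e * h = h -> h * e = h -> `|e + h| <= 1 -> `|e - h| <= 1 -> h = 0.
Proof.
move=> e_proj h_sa eh he hp hm; have [e_sa ee] := e_proj.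
pose g n := (3 / 2) ^+ n *: h.
have gP n : `|e + g n| <= 1 /\ `|e - g n| <= 1.
  elim: n => [|n [gp gm]]; first by rewrite /g expr0 scale1r.
  have g_sa : star (g n) = g n.
    by rewrite starZ h_sa rmorphXn rmorphM fmorphV !rmorph_nat.
  have eg : e * g n = g n by rewrite cstar_scaleMr eh.
  have ge : g n * e = g n by rewrite cstar_scaleMl he.
  rewrite /g exprS -scalerA; split; first exact: corner_unit_ball_expand.
  rewrite -scalerN; apply: corner_unit_ball_expand; rewrite ?opprK//.
  - by rewrite starN g_sa.
  - by rewrite mulrN eg.
  - by rewrite mulNr ge.
apply/normr0_eq0/(@mulrn_bounded_eq0 _ _ 2) => // n.
have [gp gm] := gP n.
have gn1 : `|g n| <= 1.
  apply: (@normr_mulrn_le 2) => //.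
  have -> : g n *+ 2 = (e + g n) - (e - g n).
    by rewrite opprB addrCA [e + g n]addrC addrK mulr2n.
  by rewrite [leRHS]mulr2n; apply: le_trans (ler_normB _ _) _; exact: lerD.
rewrite -[leLHS]mulr_natl.
apply: le_trans (ler_wpM2r _ (ler_nat_expr_3half _ n)) _ => //.
move: gn1; rewrite /g normrZ ger0_norm ?exprn_ge0 ?divr_ge0// => gn1.
by rewrite [leLHS]mulrnAl lerMn2r gn1 orbT.
Qed.

(** With n indices other than k, both (n+1)e - b_k = ne + (e - b_k) and (n+1)e + b_k = e + sum of
    the other e - b_i are sums of n+1 elements of the unit ball. Extremality of [e] then applies to
    b_k/(n+1). *)
Lemma sum_corner_eq0 (I : finType) e (b : I -> A) : projection e ->
  (forall i, star (b i) = b i) -> (forall i, e * b i = b i) ->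
  (forall i, b i * e = b i) -> (forall i, `|e - b i| <= 1) ->
  \sum_i b i = 0 -> forall i, b i = 0.
Proof.
move=> e_proj b_sa eb be b1 sum0 k.
have e1 := projection_norm_le1 e_proj.
pose n := #|[pred i : I | i != k]|.
have n0 : (n.+1%:R : R[i]) != 0 by rewrite pnatr_eq0.
have scale_ball x : `|e *+ n.+1 + x| <= n.+1%:R ->
    `|e + n.+1%:R^-1 *: x| <= 1.
  move=> ex; apply: (@normr_mulrn_le n.+1) => //.
  by rewrite mulrnDl -[X in _ + X]scaler_nat scalerA divff// scale1r.
have bm : `|e *+ n.+1 - b k| <= n.+1%:R.
  rewrite mulrS addrAC mulrS; apply: le_trans (ler_normD _ _) _.
  by rewrite lerD// normrMn lerMn2r e1 orbT.
have bp : `|e *+ n.+1 + b k| <= n.+1%:R.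
  have -> : e *+ n.+1 + b k = e + \sum_(i | i != k) (e - b i).
    rewrite sumrB sumr_const -/n addrA -mulrS; congr (_ + _).
    by apply/eqP; move/eqP: sum0; rewrite (bigD1 k)//= addr_eq0.
  rewrite mulrS; apply: le_trans (ler_normD _ _) _; rewrite lerD//.
  apply: le_trans (ler_norm_sum _ _ _) _.
  by rewrite -sumr_const ler_sum.
have /eqP : n.+1%:R^-1 *: b k = 0.
  apply: (corner_unit_ball_eq0 e_proj).
  - by rewrite starZ b_sa fmorphV rmorph_nat.
  - by rewrite cstar_scaleMr eb.
  - by rewrite cstar_scaleMl be.
  - exact: scale_ball.
  - by rewrite -scalerN; exact: scale_ball.
by rewrite scaler_eq0 invr_eq0 (negbTE n0) => /eqP.
Qed.

Lemma projections_sum1_orthogonal (I : finType) (p : I -> A) :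
  (forall i, projection (p i)) -> \sum_i p i = 1 ->
  forall i j, i != j -> p i * p j = 0.
Proof.
move=> p_proj sum1 i j ij.
have [p_sa pp] := (fun k => (p_proj k).1, fun k => (p_proj k).2).
pose b k := if k == i then 0 else p i * p k * p i.
have b0 : forall k, b k = 0.
  apply: (@sum_corner_eq0 _ (p i)) => // [k|k|k|k|].
  - rewrite /b; case: ifP => _; first by rewrite star0.
    by rewrite !star_mulr !p_sa mulrA.
  - by rewrite /b; case: ifP => _; rewrite ?mulr0// !mulrA pp.
  - by rewrite /b; case: ifP => _; rewrite ?mul0r// -!mulrA pp.
  - rewrite /b; case: ifP => _; first by rewrite subr0 projection_norm_le1.
    (* The difference is the compression of the projection 1 - p_k, hence a product of
       contractions. *)
    have -> : p i - p i * p k * p i = p i * (1 - p k) * p i.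
      by rewrite mulrBr mulr1 mulrBl pp.
    have : projection (1 - p k) by exact: projection_compl.
    move=> /projection_norm_le1 q1.
    by rewrite !cstar_ball1M// projection_norm_le1.
  - have -> : \sum_k b k = p i * (\sum_k p k) * p i - p i.
      rewrite mulr_sumr mulr_suml (bigD1 i)//= [in RHS](bigD1 i)//= !pp.
      rewrite [RHS]addrAC subrr add0r {1}/b eqxx add0r.
      by apply: eq_bigr => k /negbTE ki; rewrite /b ki.
    by rewrite sum1 mulr1 pp subrr.
(* Since p_i p_j p_i = (p_j p_i)^* (p_j p_i), its vanishing kills p_j p_i, and then the adjoint p_i
   p_j. *)
rewrite -[p j]p_sa -[p i]p_sa -star_mulr -[RHS]star0; congr star.
apply: cstar_eq0; rewrite star_mulr !p_sa.
have := b0 j; rewrite /b eq_sym (negbTE ij) -!mulrA.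
by rewrite [p j * (p j * _)]mulrA pp.
Qed.

End CStarNorm.

(** * Kernels of triples and tracial moments of a magic unitary *)

Definition kernel3 (T : eqType) (i : T * T * T) : bool * bool * bool :=
  (i.1.1 == i.1.2, i.1.2 == i.2, i.1.1 == i.2).

Section TracialMoments.
Variables (C : numClosedFieldType) (A : cstarType C) (N : nat) (u : 'M[A]_N).
Variables (tau : {scalar A}) (m3 : C).
Hypotheses (u_proj : forall i j, projection (u i j)).
Hypotheses (u_row : forall i, \sum_j u i j = 1).
Hypotheses (row_orth : forall i j l, j != l -> u i j * u i l = 0).
Hypotheses (col_orth : forall i k j, i != k -> u i j * u k j = 0).
Hypothesis tauC : forall a b, tau (a * b) = tau (b * a).
Hypothesis N3 : (3 <= N)%N.
Hypothesis tau3 : forall i j k l p q, uniq [:: i; k; p] -> uniq [:: j; l; q] ->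
  tau (u i j * u k l * u p q) = m3.

(** Inserting the sum of a new row expresses a moment by higher ones; the columns already in use
    contribute 0, which leaves N - 2, respectively N - 1, equal terms. *)
Let m2 : C := m3 *+ (N - 2).
Let m1 : C := m2 *+ (N - 1).

Lemma tau_magic2 i j k l : i != k -> j != l -> tau (u i j * u k l) = m2.
Proof.
move=> ik jl.
have [p] : exists p, p \notin [set i; k]%SET.
  apply/existsP; rewrite -negb_forall; apply/negP => /forallP ikT.
  have : (#|[set i; k]%SET| < #|'I_N|)%N by rewrite cards2 ik card_ord.
  by rewrite ltnNge => /negP; apply; apply/subset_leq_card/fintype.subsetP.
rewrite !inE negb_or => /andP[pi pk].
rewrite -[X in tau X]mulr1 -(u_row p) mulr_sumr raddf_sum /=.
rewrite (bigID (mem [set j; l]%SET)) /= big1 ?add0r => [|q].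
  rewrite (eq_bigr (fun _ => m3)) => [|q].
    rewrite sumr_const /m2; congr (_ *+ _).
    have -> : (N - 2 = #|~: [set j; l]%SET|)%N.
      by rewrite -[in LHS](card_ord N) -(cardsC [set j; l]%SET) cards2 jl addKn.
    by apply: eq_card => q; rewrite finset.in_setC unfold_in.
  rewrite !inE negb_or => /andP[qj ql].
  by apply: tau3; rewrite /= !inE !negb_or 1?[_ == p]eq_sym
    ?[_ == q]eq_sym ?ik ?jl ?[k == p]eq_sym ?[l == q]eq_sym ?pi ?pk ?qj ?ql.
rewrite !inE => /orP[] /eqP ->.
  (* Traciality makes the first and last factors adjacent. *)
  by rewrite tauC mulrA col_orth// mul0r raddf0.
by rewrite -mulrA col_orth ?mulr0 ?raddf0// eq_sym.
Qed.

Lemma tau_magic1 i j : tau (u i j) = m1.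
Proof.
have [k ik] : exists k, i != k.
  apply/existsP; rewrite -[X in is_true X]negbK negb_exists.
  apply/negP => /forallP iT.
  have : (#|[set i]%SET| < #|'I_N|)%N by rewrite cards1 card_ord ltnW.
  rewrite ltnNge => /negP; apply; apply/subset_leq_card/fintype.subsetP => k _.
  by rewrite inE eq_sym -[_ == _]negbK.
rewrite -[X in tau X]mulr1 -(u_row k) mulr_sumr raddf_sum /= (bigD1 j)//=.
rewrite col_orth// raddf0 add0r (eq_bigr (fun _ => m2)) => [|l jl].
  rewrite sumr_const /m1; congr (_ *+ _).
  have -> : (N - 1 = #|predC1 j|)%N by rewrite cardC1 card_ord subn1.
  by apply: eq_card => l; rewrite !inE.
by rewrite tau_magic2// eq_sym.
Qed.

(** The index of the moment is the number of blocks of the kernel; two coincidences force the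
    third. *)
Definition magic_weight3 (k : bool * bool * bool) : C :=
  if k.1.1 && k.1.2 then m1
  else if [|| k.1.1, k.1.2 | k.2] then m2 else m3.

(** A coincidence on one side only makes two factors orthogonal; a common one merges them by
    idempotence. Positions 1 and 3 become adjacent by traciality. *)
Lemma tau_tensor_cube i j : tau (tensor_cube u i j) =
  if kernel3 i == kernel3 j then magic_weight3 (kernel3 i) else 0.
Proof.
have pp k l : u k l * u k l = u k l := (u_proj k l).2.
case: i j => [[i1 i2] i3] [[j1 j2] j3]; rewrite /tensor_cube /kernel3 /=.
case: (eqVneq i1 i2) => [<-|i12]; case: (eqVneq j1 j2) => [<-|j12].
- rewrite pp.
  case: (eqVneq i1 i3) => [<-|i13]; case: (eqVneq j1 j3) => [<-|j13].
  + by rewrite pp tau_magic1.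
  + by rewrite row_orth// raddf0.
  + by rewrite col_orth// raddf0.
  + by rewrite tau_magic2.
- by rewrite row_orth// mul0r raddf0.
- by rewrite col_orth// mul0r raddf0.
case: (eqVneq i2 i3) => [<-|i23]; case: (eqVneq j2 j3) => [<-|j23].
- by rewrite -mulrA pp (negbTE i12) (negbTE j12) tau_magic2.
- by rewrite -mulrA row_orth// mulr0 raddf0.
- by rewrite -mulrA col_orth// mulr0 raddf0.
case: (eqVneq i1 i3) => [<-|i13]; case: (eqVneq j1 j3) => [<-|j13].
- by rewrite tauC mulrA pp tau_magic2.
- by rewrite tauC mulrA row_orth ?mul0r ?raddf0// eq_sym.
- by rewrite tauC mulrA col_orth ?mul0r ?raddf0// eq_sym.
- by rewrite tau3 //= !inE !negb_or ?i12 ?i13 ?i23 ?j12 ?j13 ?j23.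
Qed.

End TracialMoments.

(** * The five partition vectors and their span *)

Section PartitionVectors.
Variables (C : numClosedFieldType) (N : nat).
Local Notation idx3 := ('I_N * 'I_N * 'I_N)%type.

(** The order of the partitions is 1|2|3, 12|3, 1|23, 13|2, 123. *)
Definition in_partition3 (k : 'I_5) (i : idx3) : bool :=
  let: (e12, e23, e13) := kernel3 i in
  nth false [:: true; e12; e23; e13; e12 && e23] k.

Definition partition_comb (c : 'rV[C]_5) : {ffun idx3 -> C^o} :=
  [ffun i => \sum_k c 0 k * (in_partition3 k i)%:R].

Lemma partition_comb_is_linear : linear partition_comb.
Proof.
move=> a c d; apply/ffunP => i; rewrite !ffunE scaler_sumr -big_split.
apply: eq_bigr => k _.
by rewrite !mxE mulrDl -[a *: _]/(a * _) mulrA.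
Qed.

HB.instance Definition _ := GRing.isLinear.Build C 'rV[C]_5
  {ffun idx3 -> C^o} *:%R partition_comb partition_comb_is_linear.

Lemma partition_combE c x y z :
  partition_comb c (x, y, z) =
    c 0 (inord 0) + c 0 (inord 1) * (x == y)%:R + c 0 (inord 2) * (y == z)%:R
    + c 0 (inord 3) * (x == z)%:R + c 0 (inord 4) * ((x == y) && (y == z))%:R.
Proof.
rewrite ffunE !big_ord_recr big_ord0 /= add0r mulr1.
by do 4?[congr (_ + _)]; do ?[congr (_ * _)];
  congr (c 0 _); apply: val_inj; rewrite /= inordK.
Qed.

Section Nondegenerate.
Variables x y z : 'I_N.
Hypotheses (xy : x != y) (yz : y != z) (xz : x != z).

Let yx : y == x = false. Proof. by rewrite eq_sym (negbTE xy). Qed.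

(** Evaluation at one triple per kernel, from all distinct to all equal, gives a triangular
    system. *)
Lemma partition_comb_inj : injective partition_comb.
Proof.
apply: raddf_inj => c c0.
have E := partition_combE c; rewrite c0 in E.
have := E x y z; have := E x x y; have := E x y y; have := E x y x.
have := E x x x; rewrite !ffunE !eqxx yx (negbTE xy) (negbTE yz) (negbTE xz) /=.
rewrite !(mulr0, mulr1, addr0) => e4 e3 e2 e1 e0.
rewrite -e0 add0r in e1; rewrite -e0 add0r in e2; rewrite -e0 add0r in e3.
rewrite -e0 -e1 -e2 -e3 !add0r in e4.
apply/rowP => k; rewrite mxE -(inord_val k).
by case: k => -[|[|[|[|[|]]]]].
Qed.

Lemma partition_comb_kernel (xi : {ffun idx3 -> C^o}) :
  (forall i j, kernel3 i = kernel3 j -> xi i = xi j) ->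
  exists c, xi = partition_comb c.
Proof.
move=> xiP.
pose d := xi (x, y, z); pose d12 := xi (x, x, y); pose d23 := xi (x, y, y).
pose d13 := xi (x, y, x); pose d123 := xi (x, x, x).
(* Möbius inversion on the lattice of partitions of {1,2,3}; the 2 is its Möbius number. *)
exists (\row_k nth 0 [:: d : C; d12 - d; d23 - d; d13 - d;
  d123 - d12 - d23 - d13 + d *+ 2] k).
apply/ffunP => -[[a b] e].
rewrite partition_combE !mxE !inordK//=.
have xiE p q r : kernel3 (a, b, e) = kernel3 (p, q, r) ->
  xi (a, b, e) = xi (p, q, r) by exact: xiP.
have [[xyF yzF] xzF] := (negbTE xy, negbTE yz, negbTE xz).
have [ab|/negbTE ab] := eqVneq a b; have [be|/negbTE be] := eqVneq b e.
- subst a e; rewrite (xiE x x x) -/d123 ?eqxx /=; first by ring.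
  by rewrite /kernel3/= !eqxx.
- subst a; rewrite (xiE x x y) -/d12 ?be /=; first by ring.
  by rewrite /kernel3/= !eqxx be xyF.
- subst e; rewrite (xiE x y y) -/d23 ?ab /=; first by ring.
  by rewrite /kernel3/= !eqxx ab xyF.
have [ae|/negbTE ae] := eqVneq a e.
  subst e; rewrite (xiE x y x) -/d13 /=; first by ring.
  by rewrite /kernel3/= !eqxx ab be xyF yx.
rewrite (xiE x y z) -/d /=; first by ring.
by rewrite /kernel3/= ab be ae xyF yzF xzF.
Qed.

End Nondegenerate.
End PartitionVectors.

(** * Partition vectors are fixed by any magic unitary *)

Lemma sum_triple (V : nmodType) (I J K : finType) (F : I * J * K -> V) :
  \sum_i F i = \sum_a \sum_b \sum_c F (a, b, c).
Proof.
rewrite [RHS](pair_bigA _ (fun a b => \sum_c F (a, b, c))).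
rewrite [RHS](pair_bigA _ (fun p c => F (p.1, p.2, c))).
by apply: eq_bigr => -[[a b] c].
Qed.

Lemma sum_deltaZ (R : pzRingType) (V : lmodType R) (I : finType) (a : I)
    (F : I -> V) :
  \sum_b (a == b)%:R *: F b = F a.
Proof.
rewrite (bigD1 a)//= eqxx scale1r big1 ?addr0// => b /negbTE ba.
by rewrite eq_sym ba scale0r.
Qed.

Section PartitionFixed.
Variables (C : numClosedFieldType) (A : cstarType C) (N : nat) (u : 'M[A]_N).
Hypotheses (u_proj : forall i j, projection (u i j)).
Hypotheses (u_row : forall i, \sum_j u i j = 1).
Hypotheses (col_orth : forall i k j, i != k -> u i j * u k j = 0).

Lemma col_mul i k j : u i j * u k j = (i == k)%:R *: u i j.
Proof.
have [<-|ik] := eqVneq i k; last by rewrite col_orth// scale0r.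
by rewrite scale1r (u_proj i j).2.
Qed.

(** A free index sums its row to 1, and two indices tied together give a Kronecker delta by
    [pair_sum]. *)
Lemma in_partition3_fixed (k : 'I_5) i :
  \sum_j (in_partition3 k j)%:R *: tensor_cube u i j =
  (in_partition3 k i)%:R *: (1 : A).
Proof.
have pair_sum p q : \sum_a u p a * u q a = (p == q)%:R *: (1 : A).
  by under eq_bigr do rewrite col_mul; rewrite -scaler_sumr u_row.
case: i => [[p q] r]; rewrite sum_triple /tensor_cube /=.
case: k => -[|[|[|[|[|//]]]]] ltk; rewrite /in_partition3 /kernel3 /=.
- under eq_bigr => a _.
    under eq_bigr => b _.
      under eq_bigr => c _ do rewrite scale1r.
      rewrite -mulr_sumr u_row mulr1; over.
    rewrite -mulr_sumr u_row mulr1; over.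
  by rewrite u_row scale1r.
- rewrite -pair_sum; apply: eq_bigr => a _.
  under eq_bigr => b _.
    rewrite -scaler_sumr -mulr_sumr u_row mulr1; over.
  by rewrite sum_deltaZ.
- rewrite -[RHS]mul1r -[X in X * _](u_row p) mulr_suml; apply: eq_bigr => a _.
  rewrite -pair_sum mulr_sumr; apply: eq_bigr => b _.
  by rewrite sum_deltaZ mulrA.
- rewrite -pair_sum; apply: eq_bigr => a _.
  (* The middle row sum is inserted as a 1 between the two tied factors. *)
  rewrite exchange_big -[X in X * _]mulr1 -(u_row q) mulr_sumr mulr_suml /=.
  under eq_bigr => c _ do rewrite -scaler_sumr.
  by rewrite sum_deltaZ.
- transitivity (\sum_a u p a * u q a * u r a).
    apply: eq_bigr => a _.
    under eq_bigr => b _.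
      under eq_bigr => c _ do rewrite -mulnb natrM -scalerA.
      rewrite -scaler_sumr sum_deltaZ; over.
    by rewrite sum_deltaZ.
  have [<-|pq] := eqVneq p q.
    under eq_bigr do rewrite (u_proj _ _).2.
    exact: pair_sum.
  by rewrite scale0r big1// => a _; rewrite col_orth// mul0r.
Qed.

End PartitionFixed.

(** * Trace of a matrix model, and transitivity *)

Lemma cfun_natrE (C : numClosedFieldType) (X : topologicalType) n (x : X) :
  (n%:R : cfun C X) x = n%:R.
Proof. by elim: n => // n IHn; rewrite !mulrSr -IHn. Qed.

Lemma matrix_model_trace (C : numClosedFieldType) (N : nat)
    (G : magic_cqg C N) (K : nat) (X : topologicalType)
    (pi : G -> 'M[cfun C X]_K) (x : X) : (0 < K)%N -> matrix_model pi ->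
  exists tau : {scalar G}, [/\ forall a, tau a = ntr (pi a) x, tau 1 = 1
    & forall a b, tau (a * b) = tau (b * a)].
Proof.
move=> K0 [pi_lin [pi1 piM] _].
have tau_scalar : scalar (fun a => ntr (pi a) x).
  move=> c a b; rewrite /ntr pi_lin mxtraceD mxtraceZ.
  by rewrite [LHS]mulrDl -mulrA.
pose tau : {scalar G} := HB.pack (fun a => ntr (pi a) x)
  (GRing.isLinear.Build C G C *%R _ tau_scalar).
exists tau; split=> // [|a b] /=.
  (* Here [0 < K] rules out the default value of division by 0. *)
  by rewrite /ntr pi1 mxtrace1 cfun_natrE divff// pnatr_eq0 -lt0n.
by rewrite /ntr !piM mxtrace_mulC.
Qed.

Section Transitivity.
Variables (R : realType) (N : nat) (G : magic_cqg R[i] N).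
Variables (K : nat) (X : topologicalType) (pi : G -> 'M[cfun R[i] X]_K).
Hypotheses (K0 : (0 < K)%N) (X0 : [set: X] !=set0) (piP : matrix_model pi).

Lemma doubly_flat_transitive : doubly_flat pi -> doubly_transitive G.
Proof.
case: X0 => x _; have [tau [tauE tau1 tauC]] := matrix_model_trace x K0 piP.
move=> flat i j k l ik jl ukl0.
have [_ [_ piM] _] := piP.
have := flat i j k l x; rewrite (negbTE ik) (negbTE jl) /=.
rewrite -[_ *m _]piM -tauE ukl0 raddf0.
move/esym/eqP; rewrite invr_eq0 mulf_eq0 subr_eq0 !pnatr_eq0.
(* Two distinct indices force N > 1, so N(N - 1) is nonzero and its inverse is not the default 0. *)
have N1 : (1 < N)%N.
  rewrite ltnNge; apply: contra ik => N1.
  have ord_eq0 (a : 'I_N) : a = 0 :> nat.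
    by have := leq_trans (ltn_ord a) N1; rewrite ltnS leqn0 => /eqP.
  by rewrite -val_eqE /= !ord_eq0.
by rewrite pnatr_eq1 !gtn_eqF// ltnW.
Qed.

Lemma triple_flat_transitive :
  (3 <= N)%N -> triple_flat pi -> three_transitive G.
Proof.
case: X0 => x _; have [tau [tauE tau1 tauC]] := matrix_model_trace x K0 piP.
move=> N3 flat.
have [u_proj u_row u_col] := cqg_magic G.
have row_orth i j l : j != l -> cqg_u G i j * cqg_u G i l = 0.
  exact: (@projections_sum1_orthogonal _ _ _ (cqg_u G i)).
have col_orth i k j : i != k -> cqg_u G i j * cqg_u G k j = 0.
  exact: (@projections_sum1_orthogonal _ _ _ (fun i => cqg_u G i j)).
have tau3 i j k l p q : uniq [:: i; k; p] -> uniq [:: j; l; q] ->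
    tau (cqg_u G i j * cqg_u G k l * cqg_u G p q) =
    (N%:R * (N%:R - 1) * (N%:R - 2))^-1.
  move=> ikp jlq; rewrite tauE; have [_ [_ piM] _] := piP.
  by rewrite !piM; exact: flat.
(* Three distinct indices, from which a triple of each kernel can be formed. *)
pose y0 : 'I_N := Ordinal (ltn_trans (ltn0Sn 1) N3).
pose y1 : 'I_N := Ordinal (ltn_trans (ltnSn 1) N3).
pose y2 : 'I_N := Ordinal N3.
have [y01 y12 y02] : [/\ y0 != y1, y1 != y2 & y0 != y2] by [].
pose f := linfun (@partition_comb R[i] N).
exists (limg f) => [xi|]; last first.
  have /eqP kerf : lker f == 0%VS.
    apply/lker0P => c d; rewrite !lfunE.
    exact: (partition_comb_inj y01 y12 y02).
  by rewrite limg_dim_eq ?kerf ?capv0// dimvf.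
split.
  move=> /memv_imgP[c _ ->] i; rewrite lfunE /=.
  under eq_bigr => j _ do rewrite ffunE scaler_suml.
  rewrite exchange_big ffunE scaler_suml; apply: eq_bigr => k _ /=.
  under eq_bigr => j _ do rewrite -scalerA.
  by rewrite -scaler_sumr in_partition3_fixed// scalerA.
move=> xi_fixed.
have [|c ->] := @partition_comb_kernel _ _ _ _ _ y01 y12 y02 xi; last first.
  by rewrite -(lfunE (@partition_comb R[i] N)) memv_img ?memvf.
move=> i i' ii'.
(* The right-hand side depends on [k] only through its kernel. *)
have xiE k : xi k = \sum_j xi j * (if kernel3 k == kernel3 j then
    magic_weight3 N (N%:R * (N%:R - 1) * (N%:R - 2))^-1 (kernel3 k) else 0).
  have /(congr1 tau) := xi_fixed k.
  rewrite raddf_sum /= scalarZ tau1 mulr1 => <-.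
  apply: eq_bigr => j _; rewrite scalarZ; congr (_ * _).
  exact: (tau_tensor_cube u_proj u_row row_orth col_orth tauC N3 tau3).
by rewrite (xiE i) (xiE i') ii'.
Qed.

End Transitivity.

Theorem theorem5p4 (R : realType) (N : nat) (SN G : magic_cqg R[i] N)
    (q : SN -> G) (hS : quantum_permutation_group SN) (hG : closed_subgroup q) :
  ((exists (K : nat) (X : topologicalType)
      (pi : G -> 'M[cfun R[i] X]_K),
      [/\ (0 < K)%N, compact [set: X], [set: X] !=set0, matrix_model pi
        & doubly_flat pi]) ->
    doubly_transitive G) /\
  ((3 <= N)%N ->
   (exists (K : nat) (X : topologicalType)
      (pi : G -> 'M[cfun R[i] X]_K),
      [/\ (0 < K)%N, compact [set: X], [set: X] !=set0, matrix_model pi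
        & triple_flat pi]) ->
    three_transitive G).
Proof.
split=> [[K [X [pi [K0 _ X0 piP flat]]]]|N3 [K [X [pi [K0 _ X0 piP flat]]]]].
  exact: (doubly_flat_transitive K0 X0 piP flat).
exact: (triple_flat_transitive K0 X0 piP N3 flat).
Qed.
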